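(* Let $U\subseteq\mathbb{R}^n$ be convex, let $\varepsilon>0$, and let $f:U\to\mathbb{R}$ be bounded above on compact subsets of $U$ and satisfy $$f\Bigl(\frac{x+y}{2}\Bigr)\le\frac{f(x)+f(y)}{2}+\varepsilon\qquad\text{for all }x,y\in U.$$ Then there exist convex functions $g,g_0:U\to\mathbb{R}$ such that $$f(x)\le g(x)\le f(x)+\kappa(n)\varepsilon\quad\text{and}\quad |f(x)-g_0(x)|\le\frac{\kappa(n)}{2}\varepsilon$$ for all $x\in U$. The constant $\kappa(n)$ is the best possible constant in these inequalities; that is, in neither of the two statements can $\kappa(n)$ be replaced by a smaller constant depending only on $n$.
   Context: $\kappa(0)=0$ and $\kappa(n)=[\log_2 n]+1+n/2^{[\log_2 n]}$ for $n\ge1$, where $[\,\cdot\,]$ is the greatest integer function. *)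

(* Defs.v *)
From HB Require Import structures.
From mathcomp Require Import all_boot all_order all_algebra.
From mathcomp Require Import all_classical all_reals all_analysis.

Set Implicit Arguments.
Unset Strict Implicit.
Unset Printing Implicit Defensive.

Import Order.TTheory GRing.Theory Num.Theory.
Import numFieldNormedType.Exports.

Local Open Scope classical_set_scope.
Local Open Scope ring_scope.

(* The case n = 0 is separate: ln 0 = 0 here, so the formula would give 1. *)
Definition kappa (R : realType) (n : nat) : R :=
  if n == 0%N then 0
  else let k : int := Num.floor (ln n%:R / ln 2 : R) in
       k%:~R + 1 + n%:R / 2 ^ k.

(* A real function on U is represented by a total function on 'rV[R]_n of which
   only the values on U are constrained. *)
Definition bounded_above_on_compacts (R : realType) (n : nat)
    (U : set 'rV[R]_n) (f : 'rV[R]_n -> R) : Prop :=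
  forall K : set 'rV[R]_n, K `<=` U -> compact K -> has_ubound (f @` K).

Definition approx_midconvex (R : realType) (n : nat)
    (U : set 'rV[R]_n) (eps : R) (f : 'rV[R]_n -> R) : Prop :=
  forall x y, U x -> U y ->
    f (2^-1 *: (x + y)) <= (f x + f y) / 2 + eps.

(* Main.v *)
Require Import Defs.
From HB Require Import structures.
From mathcomp Require Import all_boot all_order all_algebra.
From mathcomp Require Import all_classical all_reals all_analysis.
From mathcomp Require Import ring lra zify.

Import Order.TTheory GRing.Theory Num.Theory.
Import numFieldNormedType.Exports.

Local Open Scope classical_set_scope.
Local Open Scope ring_scope.

(** Why the theorem is true.

    Upper bound.  It suffices to prove Jensen's inequality with an error,
    f(sum l_i p_i) <= sum l_i f(p_i) + kappa(n) eps.  The lower convex envelope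
    e of f then satisfies e <= f <= e + kappa(n) eps, and g, g0 are e raised
    by kappa(n) eps and by half of that.  Caratheodory's theorem, in a form
    that does not increase sum l_i f(p_i), leaves at most n+1 points.
    Subtracting the affine interpolant of f at these points turns the claim
    into one about a bounded function h on a simplex that is nonpositive at the
    vertices and midpoint convex up to eps.  A point l with n+1 nonzero weights
    is cut at half of its total mass: it is the midpoint of two points y and z
    whose supports share at most one vertex, so that they lie in faces of
    dimensions a and b with a + b = n.  If a, b >= 1, then induction and
    (kappa(a) + kappa(b))/2 + 1 <= kappa(a + b) (kappa_addn) give the bound.
    If, say, a = 0, then y is a vertex and h(l) <= S/2 + eps with S the
    supremum of h over the faces of dimension at most n; as S is finite, either
    S <= kappa(n) eps or S <= 2 eps, and 2 <= kappa(n).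

    The superadditivity of kappa is immediate from the formula
    kappa(n) = min_j (j + 1 + n / 2^j), whose minimum is at j = [log2 n].

    Sharpness.  Knuth and Yao determined the least expected number of fair coin
    flips that are needed to sample from a distribution x_0, ..., x_n: it is
    sum_i nu(x_i), where nu(t) = sum_j j b_j 2^-j for the binary digits b_j
    of t.  Flipping one coin to choose between samplers for x and for y yields a
    sampler for (x + y)/2, so this cost is midpoint convex up to 1, and it is 0
    at the vertices.  Hence a convex function that lies between the cost and
    the cost plus c is at most c on the simplex, and c is at least the supremum
    of the cost.  No sampler is needed to see this: nu(t) is also
    sum_k 2^-k {2^k t}, and the subadditivity of the fractional part gives the
    midpoint inequality (bit_cost_midpoint).  The fractional parts {2^k x_i},
    i = 0, ..., n, have an integer sum, which is at most min(n, 2^k), and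
    sum_k 2^-k min(n, 2^k) = kappa(n); the points of knuth_yao_point attain
    this bound for all k up to any given level.  It is enough to use finitely
    many terms of the series, which also avoids convergence questions. *)

(** * The constant kappa *)

Section Kappa.
Context {R : realType}.

Lemma kappa_trunc_log n : (0 < n)%N ->
  kappa R n = (trunc_log 2 n)%:R + 1 + n%:R / 2 ^+ trunc_log 2 n.
Proof.
move=> n_gt0; rewrite /kappa -leqn0 leqNgt n_gt0 /=.
set K := trunc_log 2 n.
have /andP[leKn ltnK] := trunc_log_bounds (isT : (1 < 2)%N) n_gt0.
have ln2_gt0 : 0 < ln 2 :> R by rewrite ln_gt0 // ltr1n.
have ln2X k : ln (2 ^ k)%:R = k%:R * ln 2 :> R.
  by rewrite natrX lnXn // mulr_natl.
have -> : Num.floor (ln n%:R / ln 2 : R) = K%:Z.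
  apply: floor_def; rewrite -pmulrn ler_pdivlMr // -ln2X.
  rewrite (_ : K%:Z + 1 = K.+1%:Z); last by rewrite -natz -[RHS]natz -natr1.
  rewrite -pmulrn ltr_pdivrMr // -ln2X.
  by rewrite ler_ln ?ltr_ln ?posrE ?ltr0n ?expn_gt0 // ler_nat ltr_nat leKn.
by rewrite -pmulrn.
Qed.

(** As a function of j, the right-hand side decreases while 2^(j+1) <= n and
    increases afterwards, so its minimum is at j = [log2 n]. *)
Lemma kappa_le_line n j : (0 < n)%N -> kappa R n <= j%:R + 1 + n%:R / 2 ^+ j.
Proof.
move=> n_gt0; rewrite kappa_trunc_log //.
have /= := trunc_log_bounds (isT : (1 < 2)%N) n_gt0.
move: (trunc_log 2 n) => K /andP[leKn ltnK].
have pow2_gt0 i : 0 < 2 ^+ i :> R by rewrite exprn_gt0.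
(* Passing from line i to line i.+1 changes the value by 1 - n / 2^(i+1). *)
have step i : i.+1%:R + 1 + n%:R / 2 ^+ i.+1
    = i%:R + 1 + n%:R / 2 ^+ i + (1 - n%:R / 2 ^+ i.+1) :> R.
  by rewrite exprS -natr1; field; rewrite expf_neq0.
have [leKj|/ltnW lejK] := leqP K j.
  rewrite -(subnKC leKj); elim: (j - K)%N => [|d IH]; first by rewrite addn0.
  rewrite addnS step; apply: le_trans IH _; rewrite lerDl subr_ge0.
  rewrite ler_pdivrMr // mul1r -natrX ler_nat (leq_trans (ltnW ltnK)) //.
  by rewrite leq_exp2l // ltnS leq_addr.
elim: K leKn lejK {ltnK} => [_|K IH leKn]; first by rewrite leqn0 => /eqP->.
rewrite leq_eqVlt => /predU1P[-> //|]; rewrite ltnS => lejK.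
have leKn' : (2 ^ K <= n)%N by apply: leq_trans leKn; rewrite leq_exp2l.
rewrite step; apply: le_trans (IH leKn' lejK).
by rewrite gerDl subr_le0 ler_pdivlMr // mul1r -natrX ler_nat.
Qed.

Lemma kappa_ge2 n : (0 < n)%N -> 2 <= kappa R n.
Proof.
move=> n_gt0; rewrite kappa_trunc_log //.
have /andP[leKn _] := trunc_log_bounds (isT : (1 < 2)%N) n_gt0.
have : 1 <= n%:R / 2 ^+ trunc_log 2 n :> R.
  by rewrite ler_pdivlMr ?exprn_gt0 // mul1r -natrX ler_nat.
have := ler0n R (trunc_log 2 n); lra.
Qed.

Lemma kappa_ge0 n : 0 <= kappa R n.
Proof.
case: n => [|n]; first by rewrite /kappa.
by apply: le_trans (kappa_ge2 n.+1 isT).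
Qed.

(** The line with index j+1 at a + b is the mean of the lines with index j at
    a and b, plus 1; choose j + 1 to be the index of the line that gives
    kappa(a + b). *)
Lemma kappa_addn a b : (0 < a)%N -> (0 < b)%N ->
  (kappa R a + kappa R b) / 2 + 1 <= kappa R (a + b).
Proof.
move=> a_gt0 b_gt0; rewrite (kappa_trunc_log (a + b)) ?addn_gt0 ?a_gt0 //.
have: (0 < trunc_log 2 (a + b))%N by apply: trunc_log_max; lia.
case: (trunc_log 2 (a + b)) => // j _.
have := kappa_le_line a j a_gt0; have := kappa_le_line b j b_gt0.
have -> : (a + b)%:R / 2 ^+ j.+1 = (a%:R / 2 ^+ j + b%:R / 2 ^+ j) / 2 :> R.
  by rewrite natrD exprS; field; rewrite expf_neq0.
rewrite -[j.+1%:R]natr1; lra.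
Qed.

End Kappa.

(** * Approximately midpoint convex functions on a simplex *)

Section Simplex.
Context {R : realType}.

Definition simplex N : set 'rV[R]_N :=
  [set l | (forall i, 0 <= l 0 i) /\ \sum_i l 0 i = 1].

Definition rv_supp N (l : 'rV[R]_N) : {set 'I_N} := [set i | l 0 i != 0]%SET.

Lemma simplex_supp_gt0 {N} {l : 'rV[R]_N} :
  simplex N l -> (0 < #|rv_supp N l|)%N.
Proof.
move=> [_ l1]; rewrite card_gt0; apply: contra_eq_neq l1 => l0.
rewrite big1 1?eq_sym ?oner_eq0 // => i _; apply/eqP/negPn.
by have := finset.in_set0 i; rewrite -l0 inE => ->.
Qed.

Lemma simplex_supp1 {N} {l : 'rV[R]_N} :
  simplex N l -> (#|rv_supp N l| <= 1)%N -> exists i, l = delta_mx 0 i.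
Proof.
move=> ls supp1; have: #|rv_supp N l| == 1%N.
  by rewrite eqn_leq supp1 simplex_supp_gt0.
move=> /finset.cards1P[i suppE]; exists i.
have l0 j : j != i -> l 0 j = 0.
  by have := finset.in_set1 j i; rewrite -suppE inE => <- /negPn/eqP.
case: ls => _; rewrite (bigD1 i) //= big1 => [|j /l0//]; rewrite addr0 => l1.
apply/rowP => j; rewrite !mxE eqxx /=.
by have [->|/l0->] := eqVneq j i; rewrite ?eqxx ?l1.
Qed.

(** Cutting the mass of l into two halves along an ordering of the vertices
    splits the weight of at most one vertex.  Iterating this gives the binary
    tree of midpoints along which the error accumulates. *)
Lemma simplex_halve {N} {l : 'rV[R]_N} : simplex N l ->
  exists y z, [/\ simplex N y, simplex N z, l = 2^-1 *: (y + z)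
    & (#|rv_supp N y| + #|rv_supp N z| <= #|rv_supp N l|.+1)%N].
Proof.
move=> [l_ge0 l1].
pose P (A : {set 'I_N}) := \sum_(i in A) l 0 i <= 2^-1.
have P0 : P finset.set0 by rewrite /P finset.big_set0 invr_ge0.
(* The maximal light set A and one further vertex j reach half of the mass;
   j is the vertex whose weight is shared. *)
have [A /maxsetP[PA maxA] _] := @maxset_exists _ P finset.set0 P0.
have [j jA] : exists j, j \notin A.
  apply/existsP; rewrite -negb_forall; apply: contraL PA => /forallP allA.
  rewrite /P (eq_bigl predT) ?l1 => [|i]; last by rewrite allA.
  by rewrite -ltNge invf_lt1 ?ltr1n.
set s := \sum_(i in A) l 0 i.
have {}PA : s <= 2^-1 := PA.
have sj : 2^-1 < s + l 0 j.
  rewrite ltNge addrC; apply: contra (jA) => PjA.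
  have <- : j |: A = A.
    by apply: maxA; rewrite ?finset.subsetUr // /P finset.big_setU1.
  by rewrite finset.setU11.
have sjC : s + l 0 j + \sum_(i | (i \notin A) && (i != j)) l 0 i = 1.
  by rewrite -l1 [RHS](bigID [in A]) /= [X in _ = _ + X](bigD1 j jA) /= addrA.
pose y : 'rV[R]_N :=
  \row_i (if i \in A then 2 * l 0 i else if i == j then 1 - 2 * s else 0).
pose z := 2 *: l - y.
have zE i : z 0 i = if i \in A then 0
    else if i == j then 2 * l 0 j - (1 - 2 * s) else 2 * l 0 i.
  rewrite !mxE; case: ifP => _; [|case: eqP => [->|_]]; rewrite ?subrr //.
  by rewrite subr0.
exists y, z; split.
- split=> [i|].
    rewrite mxE; case: ifP => _; first by rewrite mulr_ge0.
    by case: ifP => _ //; move: PA; rewrite /P -/s; lra.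
  rewrite (bigID [in A]) /= (bigD1 j jA) /= [X in _ + (_ + X)]big1 => [|i].
    rewrite addr0 mxE (negPf jA) eqxx.
    rewrite (eq_bigr (fun i => 2 * l 0 i)) => [|i iA]; last by rewrite mxE iA.
    by rewrite -mulr_sumr -/s; ring.
  by case/andP=> /negPf iA /negPf ij; rewrite mxE iA ij.
- split=> [i|].
    rewrite zE; case: ifP => // _; case: ifP => _; last by rewrite mulr_ge0.
    lra.
  rewrite (bigID [in A]) /= big1 => [|i iA]; last by rewrite zE iA.
  rewrite add0r (bigD1 j jA) /= zE (negPf jA) eqxx.
  rewrite (eq_bigr (fun i => 2 * l 0 i)) => [|i /andP[/negPf iA /negPf ij]].
    rewrite -mulr_sumr; lra.
  by rewrite zE iA ij.
- by rewrite /z addrC subrK scalerA mulVf ?scale1r.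
- (* The two supports are covered by the support of l and meet only in j. *)
  have lj : l 0 j != 0 by apply: contraTneq sj => ->; rewrite addr0 -leNgt.
  have suppU : rv_supp N y :|: rv_supp N z \subset rv_supp N l.
    apply/fintype.subsetP => i; rewrite !inE mxE zE.
    case: (i \in A); first by rewrite eqxx orbF mulf_eq0 negb_or => /andP[].
    have [-> //|_] := eqVneq i j; rewrite eqxx /=.
    by rewrite mulf_eq0 negb_or => /andP[].
  have suppI : rv_supp N y :&: rv_supp N z \subset [set j]%SET.
    apply/fintype.subsetP => i; rewrite !inE mxE zE.
    case: (i \in A); first by rewrite eqxx andbF.
    by have [//|_] := eqVneq i j; rewrite eqxx.
  rewrite -(finset.cardsUI (rv_supp N y)) -addn1 leq_add //.
    by rewrite subset_leq_card.
  by have := subset_leq_card suppI; rewrite finset.cards1.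
Qed.

(** Induction on the dimension of the face.  Halving may cut off only a vertex
    and leave a face of the same dimension; the bound M is there to make the
    supremum S over such faces finite, so that S <= S/2 + eps is informative. *)
Lemma midconvex_simplex_le {N} (h : 'rV[R]_N -> R) (eps M : R) :
    0 < eps ->
    (forall l, simplex N l -> h l <= M) ->
    (forall y z, simplex N y -> simplex N z ->
       h (2^-1 *: (y + z)) <= (h y + h z) / 2 + eps) ->
    (forall i, h (delta_mx 0 i) <= 0) ->
  forall n l, simplex N l -> (#|rv_supp N l| <= n.+1)%N ->
    h l <= kappa R n * eps.
Proof.
move=> eps_gt0 h_ub h_mid h_vert; elim/ltn_ind => n IH l ls suppl.
have [n0|n_gt0] := posnP n.
  have [i ->] : exists i, l = delta_mx 0 i.
    by move: suppl; rewrite n0 => /(simplex_supp1 ls).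
  by apply: le_trans (h_vert i) _; rewrite mulr_ge0 ?kappa_ge0 ?ltW.
pose F := [set l | simplex N l /\ (#|rv_supp N l| <= n.+1)%N].
pose S := sup (h @` F).
have h_leS l' : F l' -> h l' <= S.
  move=> Fl'; apply: ub_le_sup; last by exists l'.
  by exists M => _ [k [ks _] <-]; exact: h_ub.
have S_le : S <= Num.max (S / 2 + eps) (kappa R n * eps).
  apply: ge_sup; first by exists (h l), l.
  move=> _ [x [xs suppx] <-].
  have [y [z [ys zs xE Eab]]] := simplex_halve xs.
  have := simplex_supp_gt0 ys; have := simplex_supp_gt0 zs.
  case Ea: #|rv_supp N y| => [//|a]; case Eb: #|rv_supp N z| => [//|b] _ _.
  have {}Eab : (a + b <= n)%N.
    by have := leq_trans Eab (suppx : (_ < n.+2)%N); rewrite Ea Eb; lia.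
  rewrite le_max xE; have := h_mid y z ys zs.
  case: a => [|a] in Ea Eab *.
    have [i ->] : exists i, y = delta_mx 0 i.
      by apply: simplex_supp1; rewrite ?Ea.
    have := h_vert i; have : h z <= S by apply: h_leS; split=> //; lia.
    by move=> ? ? ?; apply/orP; left; lra.
  case: b => [|b] in Eb Eab *.
    have [i ->] : exists i, z = delta_mx 0 i.
      by apply: simplex_supp1; rewrite ?Eb.
    have := h_vert i; have : h y <= S by apply: h_leS; split=> //; lia.
    by move=> ? ? ?; apply/orP; left; lra.
  (* The faces of y and z may have a.+1 + b.+1 < n; z is placed in a larger
     one to use kappa_addn with sum n. *)
  pose b' := (n - a.+1)%N.
  have := @kappa_addn R a.+1 b' isT; rewrite subnKC; last by lia.
  move=> /(_ ltac:(lia)) kappaD hyz; apply/orP; right.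
  have hy : h y <= kappa R a.+1 * eps by apply: IH => //; lia.
  have hz : h z <= kappa R b' * eps by apply: IH => //; lia.
  have := ler_wpM2r (ltW eps_gt0) kappaD; lra.
apply: (le_trans (h_leS l _)) => //.
have := ler_wpM2r (ltW eps_gt0) (@kappa_ge2 R n n_gt0).
by move: S_le; rewrite le_max => /orP[]; lra.
Qed.

End Simplex.

(** * Convex combinations and Caratheodory's theorem *)

Section ConvexCombinations.
Context {R : realType}.

Lemma convex_setP {n} (C : set 'rV[R]_n) : convex_set C <->
  forall x y t, 0 <= t <= 1 -> C x -> C y -> C (t *: x + (1 - t) *: y).
Proof.
split=> [Cc x y t /andP[t0 t1] Cx Cy|Cc x y t /set_mem Cx /set_mem Cy].
  by have := Cc x y (Itv01 t0 t1) (mem_set Cx) (mem_set Cy); rewrite inE.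
by apply/mem_set/Cc => //; rewrite ge0 le1.
Qed.

Lemma convex_functionP {n} (C : set 'rV[R]_n) (f : 'rV[R]_n -> R) :
  convex_function C f <-> forall x y t, 0 <= t <= 1 -> C x -> C y ->
    f (t *: x + (1 - t) *: y) <= t * f x + (1 - t) * f y.
Proof.
split=> [fc x y t /andP[t0 t1] Cx Cy|fc t x y /set_mem Cx /set_mem Cy].
  exact: (fc (Itv01 t0 t1) x y (mem_set Cx) (mem_set Cy)).
by apply: fc => //; rewrite ge0 le1.
Qed.

Lemma convex_set_mulmx {n N} (C : set 'rV[R]_n) (P : 'M[R]_(N, n)) l :
  convex_set C -> (forall i, C (row i P)) -> simplex N l -> C (l *m P).
Proof.
move=> /convex_setP Cc; elim: N P l => [|N IH] P l CP [l_ge0 l1].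
  by move: l1; rewrite big_ord0 => /eqP; rewrite eq_sym oner_eq0.
rewrite mulmx_sum_row big_ord_recl; move: l1; rewrite big_ord_recl.
set t := l 0 ord0 => l1.
have l'_ge0 : 0 <= \sum_(i < N) l 0 (lift ord0 i) by exact: sumr_ge0.
have [t1|t_neq1] := eqVneq t 1.
  rewrite big1 => [|i _]; first by rewrite addr0 t1 scale1r.
  have /eqP : \sum_(i < N) l 0 (lift ord0 i) = 0 by lra.
  by rewrite psumr_eq0 // => /allP/(_ i); rewrite mem_index_enum
    => /(_ isT)/eqP ->; rewrite scale0r.
have t_lt1 : 0 < 1 - t by rewrite subr_gt0 lt_neqAle t_neq1; lra.
pose l' : 'rV[R]_N := \row_i (l 0 (lift ord0 i) / (1 - t)).
have -> : \sum_(i < N) l 0 (lift ord0 i) *: row (lift ord0 i) P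
    = (1 - t) *: (l' *m row' ord0 P).
  rewrite mulmx_sum_row scaler_sumr; apply: eq_bigr => i _.
  rewrite scalerA mxE mulrC divfK ?gt_eqF //; congr (_ *: _).
  by apply/rowP => j; rewrite !mxE.
apply: Cc => //; first by rewrite l_ge0 /=; lra.
apply: IH => [i|]; last split=> [i|].
- rewrite (_ : row i (row' ord0 P) = row (lift ord0 i) P) //.
  by apply/rowP => j; rewrite !mxE.
- by rewrite mxE divr_ge0 // ltW.
- under eq_bigr do rewrite mxE.
  by rewrite -mulr_suml (_ : \sum__ _ = 1 - t) ?divff ?gt_eqF //; lra.
Qed.

(** The rows of P indexed by S, each extended by an entry 1, are more than n+1
    vectors in a space of dimension n+1. *)
Lemma affine_dependence {n N} (P : 'M[R]_(N, n)) (S : {set 'I_N}) :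
  (n.+1 < #|S|)%N -> exists mu : 'rV[R]_N, [/\ mu != 0,
    forall i, i \notin S -> mu 0 i = 0, mu *m P = 0 & \sum_i mu 0 i = 0].
Proof.
move=> ltnS.
pose Q := row_mx P (const_mx 1 : 'cV[R]_N).
pose E : 'M[R]_(#|S|, N) := rowsub enum_val 1%:M.
have : kermx (E *m Q) != 0.
  rewrite -mxrank_eq0 mxrank_ker subn_eq0 -ltnNge.
  by apply: leq_ltn_trans (rank_leq_col _) _; rewrite addn1.
move=> /rowV0Pn[w /sub_kermxP]; rewrite mulmxA => wEQ w_neq0.
have muE i : (w *m E) 0 i = \sum_(k | enum_val k == i) w 0 k.
  rewrite mxE [RHS]big_mkcond /=; apply: eq_bigr => k _; rewrite !mxE.
  by case: eqP => _; rewrite ?mulr1 ?mulr0.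
exists (w *m E); split.
- apply: contra_neq w_neq0 => wE0; apply/rowP => k; rewrite mxE.
  have := muE (enum_val k); rewrite wE0 mxE => ->.
  by rewrite (big_pred1 k) // => k'; rewrite (inj_eq enum_val_inj).
- move=> i iS; rewrite muE big_pred0 // => k.
  by apply: contraNF iS => /eqP <-; exact: enum_valP.
- by move: wEQ; rewrite mul_mx_row -row_mx0 => /eq_row_mx[].
- move: wEQ; rewrite mul_mx_row -row_mx0 => /eq_row_mx[_ /rowP/(_ 0)].
  rewrite mxE [RHS]mxE => wE1; rewrite -[RHS]wE1.
  by apply: eq_bigr => i _; rewrite [const_mx _ _ _]mxE mulr1.
Qed.

(** Caratheodory's reduction with control of the cost sum l_i v_i: the sign of
    an affine dependence mu is chosen so that moving l in the direction -mu
    does not increase the cost, and the move stops when a weight vanishes. *)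
Lemma caratheodory_le {n N} (P : 'M[R]_(N, n)) (v : 'cV[R]_N) l :
  simplex N l -> exists l', [/\ simplex N l', l' *m P = l *m P,
    (l' *m v) 0 0 <= (l *m v) 0 0 & (#|rv_supp N l'| <= n.+1)%N].
Proof.
have [m] := ubnP #|rv_supp N l|; elim: m l => // m IH l lt_m ls.
have [le_n|lt_n] := leqP #|rv_supp N l| n.+1; first by exists l.
have [mu [mu_neq0 mu_supp muP mu1 muv]] : exists mu : 'rV[R]_N, [/\ mu != 0,
    forall i, i \notin rv_supp N l -> mu 0 i = 0, mu *m P = 0,
    \sum_i mu 0 i = 0 & 0 <= (mu *m v) 0 0].
  have [mu [mu_neq0 mu_supp muP mu1]] := affine_dependence P _ lt_n.
  have [muv|/ltW muv] := lerP 0 ((mu *m v) 0 0); first by exists mu.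
  exists (- mu); split.
  - by rewrite oppr_eq0.
  - by move=> i /mu_supp; rewrite mxE => ->; rewrite oppr0.
  - by rewrite mulNmx muP oppr0.
  - by under eq_bigr do rewrite mxE; rewrite sumrN mu1 oppr0.
  - by rewrite mulNmx mxE oppr_ge0.
(* The entries of mu have sum 0 and are not all 0, so a weight decreases. *)
have [i0 mui0] : exists i, 0 < mu 0 i.
  apply/existsP; apply: contra_neqT mu_neq0.
  rewrite negb_exists => /forallP mu_le0.
  have {}mu_le0 i : 0 <= - mu 0 i by rewrite oppr_ge0 leNgt.
  apply/rowP => i; rewrite mxE; apply/eqP; rewrite -oppr_eq0.
  have /eqP : \sum_i - mu 0 i = 0 by rewrite sumrN mu1 oppr0.
  by rewrite psumr_eq0 // => /allP/(_ i); rewrite mem_index_enum; apply.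
case: (@arg_minP _ _ _ i0 (fun i => 0 < mu 0 i) (fun i => l 0 i / mu 0 i) mui0).
move=> i1 mui1 i1_min; case: ls => l_ge0 l1.
set t := l 0 i1 / mu 0 i1 in i1_min.
have t_ge0 : 0 <= t by rewrite divr_ge0 // ltW.
have l'E i : (l - t *: mu) 0 i = l 0 i - t * mu 0 i by rewrite !mxE.
have l's : simplex N (l - t *: mu).
  split=> [i|].
    rewrite l'E subr_ge0; have [mui|mui] := ltrP 0 (mu 0 i).
      by rewrite -ler_pdivlMr // i1_min.
    by apply: le_trans (l_ge0 i); rewrite mulr_ge0_le0.
  by under eq_bigr do rewrite l'E; rewrite sumrB -mulr_sumr mu1 mulr0 subr0.
have lt_m' : (#|rv_supp N (l - t *: mu)| < m)%N.
  apply: leq_ltn_trans (_ : #|(rv_supp N l :\ i1)%SET| < m)%N; last first.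
    move: lt_m; rewrite (cardsD1 i1) inE ltnS; case: eqP => // li1.
    by move: mui1; rewrite mu_supp ?ltxx // inE li1 eqxx.
  apply/subset_leq_card/fintype.subsetP => i; rewrite !inE l'E.
  apply: contraR; rewrite negb_and !negbK => /predU1P[->|/eqP li].
    by rewrite /t divfK ?subrr ?eqxx ?gt_eqF.
  by rewrite li mu_supp ?mulr0 ?subr0 // inE li eqxx.
have [l' [l's' l'P l'v l'n]] := IH _ lt_m' l's.
exists l'; split=> //.
  by rewrite l'P mulmxBl -scalemxAl muP scaler0 subr0.
apply: le_trans l'v _; rewrite mulmxBl -scalemxAl !mxE lerBlDr lerDl.
by rewrite mulr_ge0 //; move: muv; rewrite mxE.
Qed.

Lemma continuous_mulmxr {n N} (P : 'M[R]_(N, n)) :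
  continuous (fun l : 'rV[R]_N => l *m P).
Proof.
rewrite (_ : mulmx^~ P = fun l : 'rV[R]_N => \sum_i l 0 i *: row i P).
  move=> l; apply: (cvg_big add_continuous) => [|i _].
    exact: (nbhs_filter l).
  apply: cvgZr_tmp; first exact: (nbhs_filter l).
  exact: coord_continuous.
by apply/funext => l; rewrite mulmx_sum_row.
Qed.

(** This is what makes a function that is bounded above on compact sets bounded
    on the convex hull of finitely many points. *)
Lemma compact_simplex N : compact (simplex N : set 'rV[R]_N).
Proof.
pose sumc (l : 'rV[R]_N) := \sum_i l 0 i.
have -> : simplex N = [set l : 'rV[R]_N | forall i, `[0, 1]%classic (l ord0 i)]
    `&` sumc @^-1` [set 1].
  apply/seteqP; split=> l [l_ge0 l1]; split=> // i.
    rewrite /= in_itv /= l_ge0 -l1 (bigD1 i) //= lerDl.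
    by apply: sumr_ge0 => j _; exact: l_ge0.
  by have := l_ge0 i; rewrite /= in_itv /= => /andP[].
apply: compact_closedI.
  apply: (@rV_compact R N (fun=> `[0, 1]%classic)) => i.
  exact: segment_compact.
apply: closed_comp; last exact: closed_eq.
move=> l _; apply: (cvg_big add_continuous) => [|i _].
  exact: (nbhs_filter l).
exact: coord_continuous.
Qed.

End ConvexCombinations.

(** * The convex envelope *)

Section UpperBound.
Context {R : realType} {n : nat}.
Implicit Types (U C : set 'rV[R]_n) (f : 'rV[R]_n -> R).

(** After Caratheodory's reduction, the difference h between f and the affine
    interpolation of its values at the points satisfies the hypotheses of
    midconvex_simplex_le: affine functions do not affect midpoint convexity. *)
Lemma approx_midconvex_jensen U (eps : R) f {N} (P : 'M[R]_(N, n)) l :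
    0 < eps -> convex_set U ->
    bounded_above_on_compacts U f -> approx_midconvex U eps f ->
    (forall i, U (row i P)) -> simplex N l ->
  f (l *m P) <= \sum_i l 0 i * f (row i P) + kappa R n * eps.
Proof.
move=> eps_gt0 Uc f_bd f_mid UP ls.
pose v : 'cV[R]_N := \col_i f (row i P).
have vE k : (k *m v) 0 0 = \sum_i k 0 i * f (row i P).
  by rewrite mxE; apply: eq_bigr => i _; rewrite mxE.
have [l' [l's l'P l'v l'n]] := caratheodory_le P v l ls.
pose h (k : 'rV[R]_N) := f (k *m P) - (k *m v) 0 0.
have UmulP k : simplex N k -> U (k *m P) by exact: convex_set_mulmx.
have [M M_ub] : has_ubound (f @` [set k *m P | k in simplex N]).
  apply: f_bd => [_ [k ks <-]|]; first exact: UmulP.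
  apply: continuous_compact; last exact: compact_simplex.
  by apply: continuous_subspaceT; exact: continuous_mulmxr.
pose B := \sum_i `|f (row i P)|.
suff h_le : h l' <= kappa R n * eps.
  by rewrite -vE -l'P; move: h_le; rewrite /h; lra.
apply: (@midconvex_simplex_le R N h eps (M + B)) => //.
- move=> k ks; rewrite /h lerD //.
    by apply: M_ub; exists (k *m P) => //; exists k.
  case: ks => k_ge0 k1; rewrite vE -sumrN; apply: ler_sum => i _.
  apply: le_trans (ler_norm _) _; rewrite normrN normrM ger0_norm //.
  rewrite ler_piMl // -k1 (bigD1 i) //= lerDl.
  by apply: sumr_ge0 => j _; exact: k_ge0.
- move=> y z ys zs; rewrite /h -!scalemxAl !mulmxDl.
  have := f_mid _ _ (UmulP y ys) (UmulP z zs).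
  rewrite [(_ *: (y *m v + _)) 0 0]mxE [(y *m v + _) 0 0]mxE; lra.
- by move=> i; rewrite /h -!rowE [row i v 0 0]mxE mxE subrr.
Qed.

(** The number of points is left free, since the convexity of the envelope comes
    from concatenating two convex combinations. *)
Definition envelope_values C f (x : 'rV[R]_n) : set R := [set a |
  exists N (P : 'M[R]_(N, n)) l, [/\ forall i, C (row i P), simplex N l,
    l *m P = x & a = \sum_i l 0 i * f (row i P)]].

Definition convex_envelope C f x := inf (envelope_values C f x).

Lemma envelope_values_self C f x : C x -> envelope_values C f x (f x).
Proof.
have l1 (i : 'I_1) : (const_mx 1 : 'rV[R]_1) 0 i = 1 by rewrite mxE.
have xE i : row i x = x by apply/rowP => j; rewrite !mxE (ord1 i).
move=> Cx; exists 1%N, x, (const_mx 1); split.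
- by move=> i; rewrite xE.
- by split=> [i|]; rewrite ?big_ord1 l1.
- by apply/rowP => j; rewrite mxE big_ord1 l1 mul1r.
- by rewrite big_ord1 l1 xE mul1r.
Qed.

Lemma envelope_values_conv C f x y a b t : 0 <= t <= 1 ->
  envelope_values C f x a -> envelope_values C f y b ->
  envelope_values C f (t *: x + (1 - t) *: y) (t * a + (1 - t) * b).
Proof.
move=> /andP[t_ge0 t_le1] [N [P [l [CP [l_ge0 l1] <- ->]]]].
move=> [N' [Q [k [CQ [k_ge0 k1] <- ->]]]].
exists (N + N')%N, (col_mx P Q), (row_mx (t *: l) ((1 - t) *: k)); split.
- by move=> i; case: (split_ordP i) => j ->; rewrite ?rowKu ?rowKd.
- split=> [i|].
    case: (split_ordP i) => j ->; rewrite ?row_mxEl ?row_mxEr mxE mulr_ge0 //.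
    by rewrite subr_ge0.
  rewrite big_split_ord /=.
  under eq_bigr do rewrite row_mxEl mxE.
  under [X in _ + X]eq_bigr do rewrite row_mxEr mxE.
  by rewrite -!mulr_sumr l1 k1; ring.
- by rewrite mul_row_col -!scalemxAl.
- rewrite big_split_ord /= !mulr_sumr; congr (_ + _); apply: eq_bigr => i _.
    by rewrite rowKu row_mxEl mxE mulrA.
  by rewrite rowKd row_mxEr mxE mulrA.
Qed.

Lemma convex_envelope_le C f x :
  has_lbound (envelope_values C f x) -> C x -> convex_envelope C f x <= f x.
Proof. by move=> lb Cx; apply: ge_inf => //; exact: envelope_values_self. Qed.

(** The lower bounds make the infima genuine: inf is 0 by default. *)
Lemma convex_convex_envelope C f : convex_set C ->
  (forall x, C x -> has_lbound (envelope_values C f x)) ->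
  convex_function C (convex_envelope C f).
Proof.
move=> /convex_setP Cc lb; apply/convex_functionP => x y t t01 Cx Cy.
have /andP[t_ge0 t_le1] := t01.
apply/ler_addgt0Pr => e e_gt0.
have has_infC z : C z -> has_inf (envelope_values C f z).
  by move=> Cz; split; [exists (f z); exact: envelope_values_self|exact: lb].
have [a xa a_lt] := inf_adherent e_gt0 (has_infC x Cx).
have [b yb b_lt] := inf_adherent e_gt0 (has_infC y Cy).
apply: (@le_trans _ _ (t * a + (1 - t) * b)).
  by apply: ge_inf; [apply/lb/Cc|exact: envelope_values_conv].
have -> : t * convex_envelope C f x + (1 - t) * convex_envelope C f y + e
  = t * (convex_envelope C f x + e) + (1 - t) * (convex_envelope C f y + e).
  by ring.
by rewrite lerD // ler_wpM2l // ?subr_ge0 // ltW.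
Qed.

Lemma convex_functionDr C f c :
  convex_function C f -> convex_function C (fun x => f x + c).
Proof.
move=> /convex_functionP fc; apply/convex_functionP => x y t t01 Cx Cy.
by have := fc x y t t01 Cx Cy; lra.
Qed.

Lemma approx_midconvex_between U (eps : R) f :
    convex_set U -> 0 < eps ->
    bounded_above_on_compacts U f -> approx_midconvex U eps f ->
  exists g, convex_function U g /\
    forall x, U x -> g x <= f x <= g x + kappa R n * eps.
Proof.
move=> Uc eps_gt0 f_bd f_mid.
have lb x : lbound (envelope_values U f x) (f x - kappa R n * eps).
  move=> _ [N [P [l [UP ls <- ->]]]].
  rewrite lerBlDr; exact: (approx_midconvex_jensen U).
have has_lb x : has_lbound (envelope_values U f x) by eexists; exact: lb.
exists (convex_envelope U f); split; first exact: convex_convex_envelope.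
move=> x Ux; rewrite convex_envelope_le //= -lerBlDr.
by apply: lb_le_inf; [exists (f x); exact: envelope_values_self|exact: lb].
Qed.

End UpperBound.

(** * The Knuth-Yao cost of a number *)

Section KnuthYao.
Context {R : realType}.
Implicit Types s t : R.

Definition fracpart t : R := t - (Num.floor t)%:~R.

Lemma fracpart_ge0 t : 0 <= fracpart t.
Proof. by rewrite subr_ge0 floor_le. Qed.

Lemma fracpart_lt1 t : fracpart t < 1.
Proof. by rewrite ltrBlDl; have := floorD1_gt t; rewrite intrD. Qed.

Lemma fracpart_le t : 0 <= t -> fracpart t <= t.
Proof. by move=> t_ge0; rewrite gerBl ler0z floor_ge0. Qed.

Lemma fracpart_id t : 0 <= t < 1 -> fracpart t = t.
Proof.
move=> t01; rewrite /fracpart (_ : Num.floor t = 0) ?subr0 //.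
by apply: floor_def; rewrite add0r.
Qed.

Lemma fracpartDz (z t : R) : z \is a Num.int -> fracpart (z + t) = fracpart t.
Proof.
by move=> zint; rewrite /fracpart floorDzr // intrD floorK //; ring.
Qed.

Lemma fracpartD s t : fracpart (s + t) <= fracpart s + fracpart t.
Proof.
have : Num.floor s + Num.floor t <= Num.floor (s + t).
  by rewrite floor_ge_int intrD lerD ?floor_le.
by rewrite -(ler_int R) intrD /fracpart; lra.
Qed.

(** A truncation of sum_j j b_j 2^-j, where b_j are the binary digits of the
    fractional part of t: indeed {2^k t} / 2^k = sum_(j > k) b_j 2^-j, and
    summing over k counts the digit b_j exactly j times. *)
Definition bit_cost m t : R := \sum_(k < m) fracpart (2 ^+ k * t) / 2 ^+ k.

Lemma bit_cost_le m t : bit_cost m t <= m%:R.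
Proof.
rewrite -[m in m%:R]card_ord -sumr_const; apply: ler_sum => k _.
rewrite ler_pdivrMr ?exprn_gt0 // mul1r (le_trans (ltW (fracpart_lt1 _))) //.
by rewrite exprn_ege1 // ler1n.
Qed.

Lemma bit_costD m s t : bit_cost m (s + t) <= bit_cost m s + bit_cost m t.
Proof.
rewrite -big_split /=; apply: ler_sum => k _.
by rewrite mulrDr -mulrDl ler_pM2r ?invr_gt0 ?exprn_gt0 // fracpartD.
Qed.

Lemma bit_cost_catenate m p t :
  bit_cost (m + p) t = bit_cost m t + bit_cost p (2 ^+ m * t) / 2 ^+ m.
Proof.
rewrite /bit_cost big_split_ord /= mulr_suml; congr (_ + _).
apply: eq_bigr => k _; rewrite -mulrA -invfM [2 ^+ k * (_ * t)]mulrA.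
by rewrite -!exprD addnC.
Qed.

Lemma bit_cost_shift m z t :
  z \is a Num.int -> bit_cost m (z + t) = bit_cost m t.
Proof.
move=> zint; apply: eq_bigr => k _; rewrite mulrDr fracpartDz //.
by rewrite rpredM // rpredX // intr_nat.
Qed.

Lemma bit_cost_nat m a : bit_cost m a%:R = 0.
Proof.
rewrite -[a%:R]addr0 bit_cost_shift ?intr_nat // /bit_cost big1 // => k _.
by rewrite mulr0 fracpart_id ?mul0r // lexx ltr01.
Qed.

(** Halving a number shifts its binary digits by one place: the cost is halved
    and the first term, the fractional part of the half, is added. *)
Lemma bit_cost_midpoint m s t : 0 <= s -> 0 <= t ->
  bit_cost m ((s + t) / 2) <= (s + t) / 2 + (bit_cost m s + bit_cost m t) / 2.
Proof.
move=> s_ge0 t_ge0.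
have costS_ge x : bit_cost m.-1 x <= bit_cost m x.
  case: m => [|m] //=; rewrite [leRHS]/bit_cost big_ord_recr /= lerDl.
  by rewrite divr_ge0 ?fracpart_ge0 ?exprn_ge0.
have half_ge0 : 0 <= (s + t) / 2 by lra.
case: m costS_ge => [|m] /= costS_ge; first by rewrite /bit_cost !big_ord0; lra.
rewrite -add1n bit_cost_catenate /bit_cost big_ord1 expr0 expr1 divr1 mul1r.
rewrite -/(bit_cost _ _) (mulrC 2) divfK ?pnatr_eq0 //.
have := fracpart_le _ half_ge0; have := bit_costD m s t.
have := costS_ge s; have := costS_ge t; rewrite -!/(bit_cost _ _) add1n; lra.
Qed.

(** Here 2^k t < 1 for k < m, so each of the m terms equals t. *)
Lemma bit_cost_small m t : 0 <= t -> 2 ^+ m * t < 2 -> bit_cost m t = m%:R * t.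
Proof.
move=> t_ge0 t_lt; rewrite mulr_natl -[m in RHS]card_ord -sumr_const.
apply: eq_bigr => k _; rewrite fracpart_id ?mulr_ge0 ?exprn_ge0 //=.
  by rewrite mulrAC divff ?mul1r // expf_neq0.
rewrite -(ltr_pM2l (_ : 0 < 2)) // mulr1 mulrA -exprS.
by apply: le_lt_trans t_lt; rewrite ler_wpM2r // ler_eXn2l // ltr1n.
Qed.

(** Here {- 2^k t} = 1 - 2^k t for k < m, so the terms are 2^-k - t: just below
    an integer, every fractional part is close to 1 and the cost close to 2. *)
Lemma bit_cost_neg_small m t : 0 < t -> 2 ^+ m * t <= 2 ->
  bit_cost m (- t) = 2 - 2 / 2 ^+ m - m%:R * t.
Proof.
move=> t_gt0; elim: m => [|m IH] t_le.
  by rewrite /bit_cost big_ord0 expr0; field.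
rewrite /bit_cost big_ord_recr /= -/(bit_cost m _) IH; last first.
  by apply: le_trans t_le; rewrite ler_pM2r // ler_eXn2l // ltr1n.
have pow_gt0 : 0 < 2 ^+ m :> R by rewrite exprn_gt0.
have -> : 2 ^+ m * - t = - 1 + (1 - 2 ^+ m * t) by ring.
rewrite fracpartDz ?rpredN ?rpred1 // fracpart_id; last first.
  rewrite subr_ge0 gtrBl mulr_gt0 // andbT.
  by move: t_le; rewrite exprS -mulrA; lra.
by rewrite -natr1 exprS; field; rewrite gt_eqF.
Qed.

End KnuthYao.

(** * Sharpness *)

Section Sharpness.
Context {R : realType}.

(** The standard simplex, embedded in R^n by dropping the first of its n+1
    barycentric coordinates. *)
Definition corner n : set 'rV[R]_n :=
  [set x | (forall i, 0 <= x 0 i) /\ \sum_i x 0 i <= 1].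

Definition knuth_yao m n (x : 'rV[R]_n) : R :=
  bit_cost m (1 - \sum_i x 0 i) + \sum_i bit_cost m (x 0 i).

(** The barycentric coordinates with respect to the vertices 0, e_1, ..., e_n,
    which are the rows of col_mx 0 1%:M. *)
Lemma corner_mulmx {n} (x : 'rV[R]_n) : corner n x ->
  exists l : 'rV[R]_(1 + n), simplex _ l /\ l *m col_mx 0 1%:M = x.
Proof.
move=> [x_ge0 x_le1]; exists (row_mx (1 - \sum_i x 0 i)%:M x); split.
  split=> [i|].
    case: (split_ordP i) => j ->; rewrite ?row_mxEl ?row_mxEr //.
    by rewrite mxE (ord1 j) eqxx mulr1n subr_ge0.
  rewrite big_split_ord big_ord1 /= row_mxEl mxE eqxx mulr1n.
  by under [X in _ + X]eq_bigr do rewrite row_mxEr; rewrite subrK.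
by rewrite mul_row_col mulmx0 mulmx1 add0r.
Qed.

Lemma corner_vertex n i : corner n (row i (col_mx 0 1%:M : 'M[R]_(1 + n, n))).
Proof.
case: (split_ordP i) => j ->; rewrite ?rowKu ?rowKd; split=> [k|].
- by rewrite !mxE.
- by rewrite big1 // => k _; rewrite !mxE.
- by rewrite !mxE ler0n.
- rewrite (bigD1 j) //= big1 ?addr0 => [|k /negPf kj]; rewrite !mxE ?eqxx //.
  by rewrite eq_sym kj.
Qed.

Lemma knuth_yao_vertex m n i :
  knuth_yao m n (row i (col_mx 0 1%:M : 'M[R]_(1 + n, n))) = 0.
Proof.
have cost0 : bit_cost m 0 = 0 :> R by rewrite (bit_cost_nat m 0).
have cost1 : bit_cost m 1 = 0 :> R by rewrite (bit_cost_nat m 1).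
have cost01 k : bit_cost m (row i (col_mx 0 1%:M : 'M[R]_(1 + n, n)) 0 k) = 0.
  case: (split_ordP i) => j ->; rewrite ?rowKu ?rowKd !mxE //.
  exact: bit_cost_nat.
rewrite /knuth_yao [X in _ + X]big1 // addr0.
case: (split_ordP i) => j ->; rewrite ?rowKu ?rowKd.
  by rewrite big1 ?subr0 // => k _; rewrite !mxE.
rewrite (bigD1 j) //= big1 ?addr0 => [|k /negPf kj].
  by rewrite !mxE eqxx subrr.
rewrite !mxE.
by rewrite eq_sym kj.
Qed.

Lemma convex_corner n : convex_set (corner n).
Proof.
apply/convex_setP => x y t /andP[t_ge0 t_le1] [x_ge0 x1] [y_ge0 y1].
have t'_ge0 : 0 <= 1 - t by rewrite subr_ge0.
split=> [i|]; first by rewrite !mxE addr_ge0 // mulr_ge0.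
under eq_bigr do rewrite !mxE; rewrite big_split /= -!mulr_sumr.
have := ler_wpM2l t_ge0 x1; have := ler_wpM2l t'_ge0 y1; lra.
Qed.

Lemma knuth_yao_le m n x : knuth_yao m n x <= n.+1%:R * m%:R.
Proof.
rewrite -[n.+1%:R]natr1 mulrDl mul1r addrC.
apply: lerD; first exact: bit_cost_le.
rewrite mulr_natl -[n in leRHS]card_ord -sumr_const.
by apply: ler_sum => i _; exact: bit_cost_le.
Qed.

(** The n+1 errors of bit_cost_midpoint are the barycentric coordinates of the
    midpoint, so they add up to 1. *)
Lemma knuth_yao_midconvex m n : approx_midconvex (corner n) 1 (knuth_yao m n).
Proof.
move=> x y [x_ge0 x1] [y_ge0 y1].
have mE i : (2^-1 *: (x + y)) 0 i = (x 0 i + y 0 i) / 2 by rewrite !mxE mulrC.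
rewrite /knuth_yao; under eq_bigr do rewrite mE.
under [X in _ + X]eq_bigr do rewrite mE.
rewrite -mulr_suml big_split /=.
set sx := \sum_i x 0 i in x1 *; set sy := \sum_i y 0 i in y1 *.
rewrite (_ : 1 - (sx + sy) / 2 = ((1 - sx) + (1 - sy)) / 2); last by field.
have := @bit_cost_midpoint R m (1 - sx) (1 - sy).
rewrite !subr_ge0 => /(_ x1 y1).
have : \sum_i bit_cost m ((x 0 i + y 0 i) / 2) <=
    (sx + sy + (\sum_i bit_cost m (x 0 i) + \sum_i bit_cost m (y 0 i))) / 2.
  rewrite -!big_split /= mulr_suml; apply: ler_sum => i _.
  by rewrite [leRHS]mulrDl; exact: bit_cost_midpoint.
lra.
Qed.

Lemma sum_nat_ltn n d : (d <= n)%N -> (\sum_(i < n) (i < d)%N)%N = d.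
Proof.
move=> le_dn; rewrite -{2}(minn_idPr le_dn); elim: n {le_dn} => [|n IH].
  by rewrite big_ord0 min0n.
by rewrite big_ord_recr /= IH; lia.
Qed.

(** With M = 2^(K+1) and a tiny eta, take x_i = a_i/M - eta with a_i in {1, 2}
    and sum a_i = M, which is possible because n <= M <= 2n; the remaining
    barycentric coordinate is n eta.  All n+1 coordinates are below 2^-K, so
    the fractional parts at each level k <= K sum to 2^k.  At the next p levels
    the x_i are just below multiples of 1/M, and the fractional parts sum to
    n. *)
Lemma knuth_yao_point n p : (0 < n)%N ->
  let K := trunc_log 2 n in
  exists2 x, corner n x & knuth_yao (K.+1 + p) n x
    = K%:R + 1 + n%:R / 2 ^+ K * (1 - 1 / 2 ^+ p).
Proof.
move=> n_gt0 K.
have /andP[leKn ltnK] := trunc_log_bounds (isT : (1 < 2)%N) n_gt0.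
rewrite -/K in leKn ltnK.
pose M : R := 2 ^+ K.+1.
have M_gt0 : 0 < M by rewrite exprn_gt0.
have q_gt0 : 0 < 2 ^+ p :> R by rewrite exprn_gt0.
have q_ge1 : 1 <= 2 ^+ p :> R by rewrite exprn_ege1 // ler1n.
have n_gt0' : 0 < n%:R :> R by rewrite ltr0n.
have n_ge1 : 1 <= n%:R :> R by rewrite ler1n.
(* The choice makes 2^k M n eta < 1 for all k < p. *)
pose eta : R := (n%:R * 2 ^+ p * M)^-1.
have eta_gt0 : 0 < eta by rewrite invr_gt0 !mulr_gt0.
have nqMeta : n%:R * 2 ^+ p * (M * eta) = 1.
  by rewrite mulrA divff // gt_eqF // !mulr_gt0.
have qMeta_le1 : 2 ^+ p * (M * eta) <= 1.
  by rewrite -[leRHS]nqMeta -[leRHS]mulrA ler_peMl // !mulr_ge0 // ltW.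
have Meta_le1 : M * eta <= 1.
  by apply: le_trans qMeta_le1; rewrite ler_peMl // mulr_ge0 // ltW.
have Meta_gt0 : 0 < M * eta by rewrite mulr_gt0.
pose a (i : 'I_n) : nat := (1 + (i < 2 ^ K.+1 - n))%N.
pose x : 'rV[R]_n := \row_i ((a i)%:R / M - eta).
have sum_x : \sum_i x 0 i = 1 - n%:R * eta.
  under eq_bigr do rewrite mxE; rewrite sumrB -mulr_suml -natr_sum.
  rewrite sumr_const card_ord -[eta *+ n]mulr_natl big_split /=.
  rewrite sum1_card card_ord.
  rewrite sum_nat_ltn; last first.
    by rewrite leq_subLR addnn -mul2n expnS leq_mul2l leKn.
  by rewrite subnKC 1?ltnW // natrX divff // gt_eqF.
have Mx i : M * x 0 i = (a i)%:R + - (M * eta).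
  by rewrite mxE mulrBr mulrCA divff ?mulr1 // gt_eqF.
have a_ge1 i : 1 <= (a i)%:R :> R by rewrite ler1n.
have a_le2 i : (a i)%:R <= 2 :> R by rewrite ler_nat /a; case: (_ < _)%N.
have x_ge0 i : 0 <= x 0 i.
  by rewrite -(pmulr_rge0 _ M_gt0) Mx; have := a_ge1 i; lra.
have cost_x i : bit_cost (K.+1 + p) (x 0 i)
    = K.+1%:R * x 0 i + (2 - 2 / 2 ^+ p - p%:R * (M * eta)) / M.
  rewrite bit_cost_catenate bit_cost_small //; last first.
    by rewrite -/M Mx; have := a_le2 i; lra.
  rewrite -/M Mx bit_cost_shift ?intr_nat // bit_cost_neg_small //.
  by apply: le_trans qMeta_le1 _; rewrite ler1n.
have cost_rest : bit_cost (K.+1 + p) (n%:R * eta)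
    = K.+1%:R * (n%:R * eta) + p%:R * (M * (n%:R * eta)) / M.
  have neta : 2 ^+ p * (M * (n%:R * eta)) = 1 by rewrite -[RHS]nqMeta; ring.
  have neta_ge0 : 0 <= M * (n%:R * eta).
    by rewrite mulr_ge0 ?mulr_ge0 // ltW.
  rewrite bit_cost_catenate !bit_cost_small //.
  - by rewrite -/M neta ltr1n.
  - by rewrite mulr_ge0 // ltW.
  - rewrite -/M; apply: le_lt_trans (_ : 1 < 2); last by rewrite ltr1n.
    by rewrite -[leRHS]neta ler_peMl.
exists x.
  by split=> //; rewrite sum_x gerBl mulr_ge0 // ltW.
rewrite /knuth_yao sum_x subKr cost_rest; under eq_bigr do rewrite cost_x.
rewrite big_split /= -mulr_sumr sum_x sumr_const card_ord -mulr_natl.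
rewrite -natr1 /M exprS; field.
by rewrite !gt_eqF ?exprn_gt0.
Qed.


(** A convex g with g <= f + c is at most c at the vertices of the simplex,
    where f vanishes; its sublevel set at c is convex, so g <= c on the whole
    simplex, although f exceeds c somewhere. *)
Lemma no_close_convex n c : c < kappa R n ->
  exists (U : set 'rV[R]_n) (f : 'rV[R]_n -> R),
    [/\ convex_set U, bounded_above_on_compacts U f, approx_midconvex U 1 f
      & forall g, convex_function U g ->
          ~ (forall x, U x -> f x <= g x <= f x + c)].
Proof.
have [->|n_gt0] := posnP n.
  rewrite /kappa /= => c_lt0; exists setT, (fun=> 0); split.
  - by apply/convex_setP.
  - by move=> K _ _; exists 0 => _ [x _ <-].
  - by move=> x y _ _; lra.
  - by move=> g _ /(_ 0 I); lra.
rewrite kappa_trunc_log // => c_lt.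
set K := trunc_log 2 n in c_lt.
pose d := K%:R + 1 + n%:R / 2 ^+ K - c.
have d_gt0 : 0 < d by rewrite subr_gt0.
have r_ge0 : 0 <= n%:R / 2 ^+ K / d.
  by rewrite !divr_ge0 ?exprn_ge0 // ltW.
(* 2^p exceeds p, hence the loss n / 2^(K+p) is smaller than d. *)
pose p := Num.bound (n%:R / 2 ^+ K / d).
have p_large : n%:R / 2 ^+ K / d < 2 ^+ p.
  apply: lt_le_trans (archi_boundP r_ge0) _.
  by rewrite -[leRHS]natrX ler_nat ltnW // ltn_expl.
exists (corner n), (knuth_yao (K.+1 + p) n); split.
- exact: convex_corner.
- move=> C _ _; exists (n.+1%:R * (K.+1 + p)%:R) => _ [x _ <-].
  exact: knuth_yao_le.
- exact: knuth_yao_midconvex.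
move=> g gc g_close.
have [x xc fx] := knuth_yao_point n p n_gt0; rewrite -/K in fx.
pose C := [set y | corner n y /\ g y <= c].
have Cc : convex_set C.
  apply/convex_setP => y z t t01 [yc gy] [zc gz]; split.
    by move/convex_setP: (convex_corner n); apply.
  have /convex_functionP/(_ y z t t01 yc zc) := gc.
  have /andP[t_ge0 t_le1] := t01.
  have t'_ge0 : 0 <= 1 - t by rewrite subr_ge0.
  have := ler_wpM2l t_ge0 gy; have := ler_wpM2l t'_ge0 gz; lra.
have [l [ls lx]] := corner_mulmx x xc.
have [_ gx] : C x.
  rewrite -lx; apply: convex_set_mulmx => // i.
  split; first exact: corner_vertex.
  have /andP[_] := g_close _ (corner_vertex n i).
  by rewrite knuth_yao_vertex add0r.
have /andP[fgx _] := g_close x xc.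
have : n%:R / 2 ^+ K * (1 / 2 ^+ p) < d.
  by rewrite mulrA mulr1 ltr_pdivrMr ?exprn_gt0 // [ltRHS]mulrC -ltr_pdivrMr.
by move: fgx gx; rewrite fx /d; lra.
Qed.

End Sharpness.

Theorem theorem2p39 (R : realType) (n : nat) :
  [/\ forall (U : set 'rV[R]_n) (eps : R) (f : 'rV[R]_n -> R),
        convex_set U -> 0 < eps ->
        bounded_above_on_compacts U f -> approx_midconvex U eps f ->
        exists g g0 : 'rV[R]_n -> R,
          [/\ convex_function U g, convex_function U g0,
              forall x, U x -> f x <= g x <= f x + kappa R n * eps
            & forall x, U x -> `|f x - g0 x| <= kappa R n / 2 * eps],
      forall c : R, c < kappa R n ->
        ~ (forall (U : set 'rV[R]_n) (eps : R) (f : 'rV[R]_n -> R),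
             convex_set U -> 0 < eps ->
             bounded_above_on_compacts U f -> approx_midconvex U eps f ->
             exists g : 'rV[R]_n -> R,
               convex_function U g /\
               forall x, U x -> f x <= g x <= f x + c * eps)
    & forall c : R, c < kappa R n ->
        ~ (forall (U : set 'rV[R]_n) (eps : R) (f : 'rV[R]_n -> R),
             convex_set U -> 0 < eps ->
             bounded_above_on_compacts U f -> approx_midconvex U eps f ->
             exists g0 : 'rV[R]_n -> R,
               convex_function U g0 /\
               forall x, U x -> `|f x - g0 x| <= c / 2 * eps)].
Proof.
split=> [U eps f Uc eps_gt0 f_bd f_mid|c c_lt all_c|c c_lt all_c].
- have [g [gc g_f]] := approx_midconvex_between U eps f Uc eps_gt0 f_bd f_mid.
  exists (fun x => g x + kappa R n * eps), (fun x => g x + kappa R n / 2 * eps).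
  split; try exact: convex_functionDr.
    by move=> x /g_f; lra.
  by move=> x /g_f; rewrite ler_norml; lra.
- have [U [f [Uc f_bd f_mid no_g]]] := no_close_convex n c c_lt.
  have [g [gc g_f]] := all_c U 1 f Uc ltr01 f_bd f_mid.
  by apply: no_g gc _ => x Ux; rewrite -[c]mulr1 g_f.
- have [U [f [Uc f_bd f_mid no_g]]] := no_close_convex n c c_lt.
  have [g [gc g_f]] := all_c U 1 f Uc ltr01 f_bd f_mid.
  apply: (no_g (fun x => g x + c / 2)); first exact: convex_functionDr.
  by move=> x /g_f; rewrite ler_norml; lra.
Qed.
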